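(* For every odd integer $m\geq 3$ and every integer $K\geq 0$ there exists an irrational real $\alpha_{m,K}$ such that $B(2^k\alpha_{m,K})=m$ for all integers $0\leq k\leq K$.
   Context: For an irrational real $x=[a_0;a_1,a_2,\ldots]$ (simple continued fraction), $B(x)=\limsup_{n\to\infty}a_n(x)$, where $a_n(x)$ is the $n$-th partial quotient. *)

(* Defs.v *)
From HB Require Import structures.
From mathcomp Require Import all_boot all_order all_algebra.
From mathcomp Require Import all_classical all_reals all_analysis.

Set Implicit Arguments.
Unset Strict Implicit.
Unset Printing Implicit Defensive.

Import Order.TTheory GRing.Theory Num.Theory.

Local Open Scope ring_scope.

(* The complete quotients x_0 = x, x_{n+1} = 1 / (x_n - floor x_n).  The
   denominator never vanishes when x is irrational; for rational x the sequence
   eventually takes the junk value 0, since 0^-1 = 0. *)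
Definition complete_quotient (R : realType) (x : R) (n : nat) : R :=
  iter n (fun y : R => (y - (Num.floor y)%:~R)^-1) x.

Definition partial_quotient (R : realType) (x : R) (n : nat) : int :=
  Num.floor (complete_quotient x n).

(* Extended-real valued: +oo exactly when the partial quotients are unbounded. *)
Definition limsup_partial_quotient (R : realType) (x : R) : \bar R :=
  limn_esup (fun n => ((partial_quotient x n)%:~R)%:E).

(* Main.v *)
Require Import Defs.
From HB Require Import structures.
From mathcomp Require Import all_boot all_order all_algebra.
From mathcomp Require Import all_classical all_reals all_analysis.
From mathcomp Require Import zify ring lra.

Set Implicit Arguments.
Unset Strict Implicit.
Unset Printing Implicit Defensive.

Import Order.TTheory GRing.Theory Num.Theory.

Local Open Scope ring_scope.

(* Let w = (m + sqrt (m^2 + 8)) / 2, so that w^2 = m w + 2 and w has norm -2.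
   The prime 2 splits in Z[w] and one prime above it is generated by w, hence
   for an even root b of X^2 - m X - 2 modulo 2^K and j <= K the lattice
   <2^j, w - b> is the principal ideal (w^j).  Thus alpha = (w - b) / 2^K has the
   property that each 2^k alpha with k <= K is GL_2(Z)-equivalent to w, and has
   the same tail of partial quotients as w (Serret).  The number w is reduced, so
   its expansion is purely periodic (Galois) and its first partial quotient m
   recurs, while any reduced number of discriminant m^2 + 8 is less than m + 1. *)

(** * Limit superior of a sequence that attains its bound *)

(** Every tail from rank [N] on attains its upper bound [l], so the tail suprema are eventually
    constant. *)
Lemma limn_esup_eq_max (R : realType) (u : (\bar R)^nat) (l : \bar R) (N : nat) :
  (forall n, (N <= n)%N -> (u n <= l)%E) ->
  (forall k, exists2 n, (k <= n)%N & u n = l) -> limn_esup u = l.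
Proof.
move=> ule ueq; rewrite limn_esup_lim; apply: cvg_lim => //.
suff H n : (N <= n)%N -> esups u n = l.
  apply: (@cvg_trans _ (cst l @ \oo)%classic); last exact: cvg_cst.
  by apply: near_eq_cvg; near=> n; rewrite H//; near: n; exact: nbhs_infty_ge.
move=> Nn; apply/eqP; rewrite eq_le; apply/andP; split.
  apply: ub_ereal_sup => _ [k /= nk <-]; exact: ule (leq_trans Nn nk).
by have [k nk <-] := ueq n; apply: ereal_sup_ubound; exists k.
Unshelve. all: by end_near. Qed.

(** * Continued fractions with a common tail (Serret) *)

Lemma complete_quotientD (R : realType) (x : R) (i n : nat) :
  complete_quotient x (n + i) = complete_quotient (complete_quotient x i) n.
Proof. by rewrite /complete_quotient iterD. Qed.

(** Complete quotients are compared instead of partial ones, which avoids any convergence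
    argument. *)
Definition same_tail (R : realType) (x y : R) :=
  exists i j, complete_quotient x i = complete_quotient y j.

Section SameTail.
Variable R : realType.
Implicit Types x y z : R.

Lemma same_tail_refl x : same_tail x x.
Proof. by exists 0%N, 0%N. Qed.

Lemma same_tail_sym x y : same_tail x y -> same_tail y x.
Proof. by move=> [i [j e]]; exists j, i. Qed.

Lemma same_tail_trans y x z : same_tail x y -> same_tail y z -> same_tail x z.
Proof.
move=> [i [j e]] [k [l f]]; exists (k + i)%N, (j + l)%N.
by rewrite complete_quotientD e -complete_quotientD addnC complete_quotientD f
  -complete_quotientD.
Qed.

Lemma same_tail_addz x (n : int) : same_tail x (x + n%:~R).
Proof.
exists 1%N, 1%N; rewrite /complete_quotient /=.
by rewrite floorDrz ?intr_int// intrKfloor intrD; congr (_^-1); ring.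
Qed.

Lemma same_tail_next x i y j :
  same_tail (complete_quotient x i) (complete_quotient y j) -> same_tail x y.
Proof.
by move=> [k [l e]]; exists (k + i)%N, (l + j)%N; rewrite !complete_quotientD.
Qed.

(** If [x = a + y] with [0 < y < 1/2], then [- x = [- a - 1; 1, y^-1 - 1]]: two steps from [- x] and
    one step from [x] differ by an integer. *)
Lemma same_tail_opp x : same_tail x (- x).
Proof.
wlog : x / x - (Num.floor x)%:~R <= 1 / 2.
  move=> wl; have [/wl//|h] := leP (x - (Num.floor x)%:~R) (1 / 2).
  apply: same_tail_sym; rewrite -[X in same_tail _ X]opprK; apply: wl.
  have -> : Num.floor (- x) = - Num.floor x - 1.
    apply: floor_def; have := floor_itv x; rewrite !(intrD, intrN) => /andP[_ h2].
    by apply/andP; split; lra.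
  by have := floorD1_gt x; rewrite !(intrD, intrN); lra.
set y := x - _ => y2.
have y0 : 0 <= y by have := floor_le x; rewrite /y; lra.
(* For an integer [x] both expansions reach the default value [0^-1 = 0]. *)
have [y00|yn0] := eqVneq y 0.
  have xE : x = (Num.floor x)%:~R by move: y00; rewrite /y; lra.
  exists 1%N, 1%N; rewrite /complete_quotient /=; move: (Num.floor x) xE => z ->.
  by rewrite -intrN !intrKfloor intrN !subrr.
have yp : 0 < y by rewrite lt_neqAle eq_sym yn0.
have fN : Num.floor (- x) = - Num.floor x - 1.
  apply: floor_def; rewrite !(intrD, intrN); move: yp y2; rewrite /y => *.
  by apply/andP; split; lra.
have c1 : complete_quotient (- x) 1 = (1 - y)^-1.
  by rewrite /complete_quotient /= fN !(intrD, intrN) /y; congr (_^-1); ring.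
have [y12|y12] := eqVneq y (1 / 2).
  by exists 1%N, 1%N; rewrite c1 /complete_quotient /= -/y y12; congr (_^-1); lra.
have ylt : y < 1 / 2 by rewrite lt_neqAle y12.
apply: (@same_tail_next x 1 (- x) 2).
have -> : complete_quotient (- x) 2 = y^-1 + (-1)%:~R.
  rewrite -[2%N]/(1 + 1)%N complete_quotientD c1 /complete_quotient /=.
  have -> : Num.floor (1 - y)^-1 = 1.
    apply: floor_def; apply/andP; split; first by rewrite invf_ge1; lra.
    by rewrite -[(1 + 1)%:~R]/(2 : R) invf_plt ?posrE; lra.
  rewrite intrN; field; apply/andP; split => //.
  by rewrite gt_eqF//; lra.
exact: same_tail_addz.
Qed.

(** Up to sign and inversion [1 < x]; then [x^-1] has integer part 0 and one step gives back [x]. *)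
Lemma same_tail_inv x : same_tail x x^-1.
Proof.
wlog x0 : x / 0 < x.
  move=> wl; have [/wl//|x0|<-] := ltgtP 0 x; last first.
    by rewrite invr0; exact: same_tail_refl.
  apply: same_tail_trans (same_tail_opp x) _.
  apply: (@same_tail_trans (- x)^-1); first by apply: wl; lra.
  by rewrite invrN; apply: same_tail_sym; exact: same_tail_opp.
wlog x1 : x x0 / 1 < x.
  move=> wl; have [/(wl _ x0)//|x1|<-] := ltgtP 1 x; last first.
    by rewrite invr1; exact: same_tail_refl.
  apply: same_tail_sym; rewrite -[X in same_tail _ X]invrK; apply: wl.
    by rewrite invr_gt0.
  by rewrite invf_gt1.
exists 0%N, 1%N; rewrite /complete_quotient /=.
have -> : Num.floor x^-1 = 0.
  by apply: floor_def; rewrite invr_ge0 (ltW x0)/= invf_lt1.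
by rewrite subr0 invrK.
Qed.

(* Euclid's algorithm on the left column (a, c). *)
Lemma same_tail_moebius x y (a b c d : int) :
  (forall u v : int, u%:~R * x + v%:~R = 0 -> u = 0 /\ v = 0) ->
  `|a * d - b * c| = 1 ->
  y * (c%:~R * x + d%:~R) = a%:~R * x + b%:~R -> same_tail x y.
Proof.
move=> xirr; have [n] := ubnP `|c|%N.
elim: n => // n IHn in y a b c d *; rewrite ltnS => cn det e.
have [c0|c0] := eqVneq c 0.
  (* Here [a] and [d] are units, so [y] is [x] or [- x] up to an integer. *)
  subst c; rewrite mul0r add0r in e; rewrite mulr0 subr0 in det.
  have d0 : d%:~R != 0 :> R by rewrite intr_eq0; apply/eqP => d0; lia.
  have d2 : d * d = 1.
    have /eqP : (`|a| * `|d| = 1)%N by rewrite -abszM; lia.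
    by rewrite muln_eq1 => /andP[_ /eqP d1]; have [->|->] : d = 1 \/ d = -1 by lia.
  have yE : y = y * d%:~R * d%:~R by rewrite -mulrA -intrM d2 mulr1.
  have [ad|ad] : a * d = 1 \/ a * d = -1 by lia.
    have -> : y = x + (b * d)%:~R.
      by rewrite yE e mulrDl mulrAC -!intrM ad; ring.
    exact: same_tail_addz.
  have -> : y = - x + (b * d)%:~R.
    by rewrite yE e mulrDl mulrAC -!intrM ad; ring.
  exact: same_tail_trans (same_tail_opp x) (same_tail_addz _ _).
set q := (a %/ c)%Z; set r := (a %% c)%Z.
have aE : a = q * c + r by exact: divz_eq.
have e' : (y + (- q)%:~R) * (c%:~R * x + d%:~R) = r%:~R * x + (b - q * d)%:~R.
  by rewrite mulrDl e aE !(intrD, intrM, intrN); ring.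
apply: (@same_tail_trans (y + (- q)%:~R)^-1); last first.
  apply: same_tail_sym.
  exact: same_tail_trans (same_tail_addz y (- q)) (same_tail_inv _).
(* If [y = q], then [r] and [b - q * d] vanish, and so does the determinant. *)
have yq : y + (- q)%:~R != 0.
  apply/eqP => h; move: e'; rewrite h mul0r => /esym/xirr[r0 b0].
  by move: det; rewrite aE r0 (_ : b = q * d); [nia|lia].
(* Subtracting [q] and inverting puts the remainder [r], smaller than [|c|], in the lower left
   corner. *)
apply: (IHn _ c d r (b - q * d)).
- have := ltz_mod a c0; have := modz_ge0 a c0; rewrite -/r; lia.
- by rewrite -det aE; rewrite -normrN; congr `|_|; ring.
- by rewrite -e' mulKf.
Qed.

Lemma same_tail_limsup x y (m : nat) :
  same_tail x y ->
  (forall n, partial_quotient y n <= m%:Z) ->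
  (forall k, exists2 n, (k <= n)%N & partial_quotient y n = m%:Z) ->
  limsup_partial_quotient x = (m%:R)%:E.
Proof.
move=> [i [j e]] yle yeq.
have ts n : partial_quotient x (n + i) = partial_quotient y (n + j).
  by rewrite /partial_quotient !complete_quotientD e.
apply: (@limn_esup_eq_max _ _ _ i) => [n ni|k].
  rewrite lee_fin -(subnK ni) ts -[m%:R]/(m%:Z%:~R) ler_int; exact: yle.
have [n kn yn] := yeq (k + j)%N; exists ((n - j) + i)%N; first by lia.
by rewrite ts subnK ?yn//; lia.
Qed.

End SameTail.

(** * Reduced quadratic forms and pure periodicity (Galois) *)

Section ReducedForms.
Variables (R : realType) (N : int) (s : R).
Hypothesis sqr_s : s ^+ 2 = N%:~R.
Hypothesis N_nonsquare : forall z : int, z ^+ 2 != N.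

(* A triple (A, B, C) stands for the form A X^2 - B X - C of discriminant
   N = s^2, with roots (B + s) / (2 A) and (B - s) / (2 A). *)
Definition form_root (f : int * int * int) : R :=
  let: (A, B, C) := f in (B%:~R + s) / (2 * A%:~R).

(* The last two inequalities say that the positive root exceeds 1 and that the
   other one lies in ]-1, 0[. *)
Definition reduced (f : int * int * int) : Prop :=
  let: (A, B, C) := f in
  [/\ B ^+ 2 + 4 * (A * C) = N, 0 < A, 0 < C,
      2 * A%:~R < B%:~R + s & 2 * C%:~R < B%:~R + s].

(** Substitute [X = a + 1 / Y] in [A X^2 - B X - C] and multiply by [- Y^2]. *)
Definition gauss_step (f : int * int * int) : int * int * int :=
  let: (A, B, C) := f in
  let a := Num.floor (form_root f) in
  (C + B * a - A * a ^+ 2, 2 * A * a - B, A).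

Lemma reduced_disc A B C : reduced (A, B, C) ->
  (s - B%:~R) * (s + B%:~R) = 4 * (A%:~R * C%:~R).
Proof.
move=> [e _ _ _ _]; have : (B ^+ 2 + 4 * (A * C))%:~R = N%:~R :> R by rewrite e.
by rewrite -sqr_s intrD rmorphXn !intrM /= => h; lra.
Qed.

(** Dividing [(s - B) (s + B) = 4 A C] by [s + B > 2 C] bounds [s - B] by [2 A < s + B], whence
    [0 < B]. *)
Lemma reduced_lt A B C : reduced (A, B, C) ->
  [/\ 0 < B, B%:~R < s & s - B%:~R < 2 * A%:~R].
Proof.
move=> /[dup] /reduced_disc d [_ A0 C0 h1 h2].
have A0' : 0 < A%:~R :> R by rewrite ltr0z.
have C0' : 0 < C%:~R :> R by rewrite ltr0z.
have BsA : 0 < B%:~R + s by apply: lt_trans h1; lra.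
rewrite -(ltr0z R); move: d h1 h2 A0' C0' BsA.
move: (A%:~R) (B%:~R) (C%:~R) => a b c d h1 h2 a0 c0 bs.
have sb : s - b < 2 * a.
  by rewrite -(ltr_pM2r bs) [b + s]addrC d; nra.
by split => //; nra.
Qed.

Lemma reduced_gauss_step f : reduced f ->
  reduced (gauss_step f) /\
  (form_root f - (Num.floor (form_root f))%:~R)^-1 = form_root (gauss_step f).
Proof.
case: f => [[A B] C] /[dup] rf /[dup] /reduced_lt [B0 Bs sB] /[dup] /reduced_disc d.
case=> e A0 C0 h1 h2; rewrite /gauss_step.
set x := form_root _; set a := Num.floor x.
have A0' : 0 < A%:~R :> R by rewrite ltr0z.
have xA : x * (2 * A%:~R) = B%:~R + s.
  by rewrite /x /form_root divfK// mulf_neq0// gt_eqF.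
have x1 : 1 < x by rewrite -(ltr_pM2r (_ : 0 < 2 * A%:~R)) ?xA; lra.
have a1 : 1 <= a by rewrite floor_ge_int ltW.
have a1' : 1 <= a%:~R :> R by rewrite (ler_int R 1).
have ax : a%:~R <= x by exact: floor_le.
have xa1 : x < a%:~R + 1 by have := floorD1_gt x; rewrite intrD.
set B' := 2 * A * a - B; set A' := C + B * a - A * a ^+ 2.
have e' : B' ^+ 2 + 4 * (A' * A) = N by rewrite /A' /B' -e; ring.
have B'E : B'%:~R = 2 * A%:~R * a%:~R - B%:~R :> R.
  by rewrite intrD intrN !intrM.
have B's : B'%:~R <= s by rewrite B'E; nra.
have sB' : - s < B'%:~R by rewrite B'E; nra.
have d' : (s - B'%:~R) * (s + B'%:~R) = 4 * (A'%:~R * A%:~R).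
  have : (B' ^+ 2 + 4 * (A' * A))%:~R = N%:~R :> R by rewrite e'.
  by rewrite -sqr_s intrD rmorphXn !intrM /= => h; lra.
have A'0 : 0 < A'.
  (* [A' = 0] would make [N] the square of [B']. *)
  rewrite lt_neqAle; apply/andP; split.
    by apply/eqP => A'0; have := N_nonsquare B';
      rewrite -e' -A'0 mul0r mulr0 addr0 eqxx.
  by rewrite -(ler0z R) -(pmulr_lge0 _ A0'); nra.
have A'0' : 0 < A'%:~R :> R by rewrite ltr0z.
have B's' : B'%:~R < s.
  rewrite lt_neqAle B's andbT; apply/eqP => h.
  by move: d'; rewrite h subrr mul0r => /eqP; rewrite eq_sym gt_eqF//; nra.
have inv : (x - a%:~R)^-1 = (B'%:~R + s) / (2 * A'%:~R).
  have -> : x - a%:~R = (s - B'%:~R) / (2 * A%:~R).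
    by rewrite /x /form_root B'E; field; rewrite gt_eqF.
  apply/eqP; rewrite invf_div eqr_div; last 2 first.
  - by rewrite gt_eqF//; lra.
  - by rewrite gt_eqF//; lra.
  by apply/eqP; lra.
split=> //; split => //.
- rewrite -[X in X < _]mul1r -ltr_pdivlMr; last by lra.
  rewrite -inv invf_gt1 ?subr_gt0; first by lra.
  rewrite lt_neqAle ax andbT; apply/eqP => h.
  by move: B's'; rewrite B'E h [2 * _ * _]mulrC xA; lra.
- by rewrite B'E; nra.
Qed.

Lemma reduced_iter f n : reduced f -> reduced (iter n gauss_step f).
Proof. by move=> rf; elim: n => //= n /reduced_gauss_step []. Qed.

Lemma complete_quotient_form_root f n : reduced f ->
  complete_quotient (form_root f) n = form_root (iter n gauss_step f).
Proof.
move=> rf; rewrite /complete_quotient; elim: n => //= n ->.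
by have [_ ->] := reduced_gauss_step (reduced_iter n rf).
Qed.

(* The partial quotient a is read off the image (A', B', C') of a step, as the
   integer part of (B' + s) / (2 C'). *)
Lemma gauss_step_inj f g : reduced f -> reduced g ->
  gauss_step f = gauss_step g -> f = g.
Proof.
have key A B C : reduced (A, B, C) ->
    let: (A', B', C') := gauss_step (A, B, C) in
    Num.floor (form_root (A, B, C)) = Num.floor ((B'%:~R + s) / (2 * C'%:~R)).
  move=> /[dup] /reduced_lt [B0 Bs sB] [_ A0 _ _ _].
  have A0' : 0 < A%:~R :> R by rewrite ltr0z.
  rewrite /gauss_step; set a := Num.floor _; apply/esym/floor_def.
  (* The remainder [(s - B) / (2 A)] is minus the conjugate root, hence lies in [[0, 1[]. *)
  have -> : ((2 * A * a - B)%:~R + s) / (2 * A%:~R) =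
      a%:~R + (s - B%:~R) / (2 * A%:~R).
    by rewrite intrD intrN !intrM; field; rewrite gt_eqF.
  rewrite intrD lerDl ltrD2l divr_ge0//=; try lra.
  by rewrite ltr_pdivrMr ?mul1r//; lra.
case: f g => [[A B] C] [[A2 B2] C2] /key h1 /key h2 E.
rewrite E in h1; move: h1; rewrite /= in h2 *; rewrite -h2 => aE.
move: E; rewrite /gauss_step aE; set a := Num.floor _.
case=> eA eB eC; move: eA; subst A2; have -> : B = B2 by lia.
by move=> eA; have -> : C = C2 by lia.
Qed.

(** There are finitely many reduced forms, so two iterates coincide; injectivity of the step carries
    the coincidence back to [f] itself. *)
Lemma reduced_periodic f : reduced f ->
  exists2 p, (0 < p)%N & iter p gauss_step f = f.
Proof.
move=> rf; pose n := `|N|%N.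
pose code (g : int * int * int) : 'I_n.+1 * 'I_n.+1 * 'I_n.+1 :=
  (inord `|g.1.1|%N, inord `|g.1.2|%N, inord `|g.2|%N).
have codeI g h : reduced g -> reduced h -> code g = code h -> g = h.
  case: g h => [[A B] C] [[A2 B2] C2] rg rh.
  have [B0 _ _] := reduced_lt rg; have [B20 _ _] := reduced_lt rh.
  case: rg rh => eg A0 C0 _ _ [eh A20 C20 _ _].
  case=> /(congr1 val) /= + /(congr1 val) /= + /(congr1 val) /=.
  (* [inord] is faithful only up to [n]; positivity and [B^2 + 4 A C = N] keep all coefficients in
     that range. *)
  by rewrite !inordK => [? ? ?||||||]; [congr (_, _, _); lia|rewrite /n; nia..].
pose F (i : 'I_(#|{: 'I_n.+1 * 'I_n.+1 * 'I_n.+1}|.+1)) :=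
  code (iter i gauss_step f).
have [i [j [ij eij]]] : exists i j, i != j /\ F i = F j.
  apply: contrapT => h; suff /leq_card : injective F by rewrite card_ord ltnn.
  by move=> i j e; apply/eqP; apply: contrapT => /negP ij; apply: h; exists i, j.
wlog lij : i j ij eij / (i < j)%N.
  move=> wl; have [/wl|/wl|e] := ltngtP i j; first exact.
    by apply; rewrite // eq_sym.
  by move: ij; rewrite (val_inj e) eqxx.
exists (j - i)%N; first by rewrite subn_gt0.
have {eij} : iter i gauss_step f = iter (i + (j - i)) gauss_step f.
  by rewrite subnKC ?(ltnW lij)//; apply: codeI => //; exact: reduced_iter.
move: (j - i)%N => p; elim: (nat_of_ord i) => [/esym//|k IHk].
rewrite addSn !iterS => /gauss_step_inj H.
by apply: IHk; apply: H; exact: reduced_iter.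
Qed.

Lemma partial_quotient_recurrent f k : reduced f ->
  exists2 n, (k <= n)%N &
    partial_quotient (form_root f) n = Num.floor (form_root f).
Proof.
move=> rf; have [p p0 pf] := reduced_periodic rf.
exists (k * p)%N; first by rewrite leq_pmulr.
rewrite /partial_quotient complete_quotient_form_root//.
congr (Num.floor (form_root _)).
by elim: k => //= k IHk; rewrite mulSn iterD IHk.
Qed.

End ReducedForms.

(** * Arithmetic at the split prime 2 *)

(* Hensel lifting of the root 0 modulo 2. *)
Lemma even_root_mod_pow2 (m : int) (K : nat) : ~~ (2 %| m)%Z ->
  exists2 b : int, (2 %| b)%Z & (2 ^+ K %| b ^+ 2 - m * b - 2)%Z.
Proof.
move=> m_odd.
suff [b [c e]] : exists b c : int, (2 * c) ^+ 2 - m * (2 * c) - 2 = 2 ^+ K.+1 * b.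
  exists (2 * c); first by rewrite dvdz_mulr.
  by rewrite e exprS -mulrA dvdz_mull// dvdz_mulr.
elim: K => [|K [b [c e]]]; first by exists (-1), 0; ring.
have [b_even|b_odd] := boolP (2 %| b)%Z.
  by have /dvdzP[b' bE] := b_even; exists b', c; rewrite e bE [in RHS]exprS; ring.
(* Shifting the root [2 c] by [2 ^ K.+1] adds [4 c + 2 ^ K.+1 - m] to the cofactor [b]; this is odd,
   so an odd [b] becomes even. *)
have /dvdzP[b' bE] : (2 %| b + 4 * c + 2 ^+ K.+1 - m)%Z by rewrite exprS; lia.
exists b', (c + 2 ^+ K).
have -> : (2 * (c + 2 ^+ K)) ^+ 2 - m * (2 * (c + 2 ^+ K)) - 2 =
    2 ^+ K.+1 * b + 2 ^+ K.+1 * (4 * c + 2 ^+ K.+1 - m).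
  by rewrite -e [2 ^+ K.+1]exprS; ring.
rewrite -mulrDr !addrA.
by rewrite bE [2 ^+ K.+2]exprS; ring.
Qed.

(* Multiplying by the conjugate m - w of w, which has norm -2, passes from j to
   j.+1; the factor 2 gained on the right can be split off because q is even. *)
Lemma unimodular_pow2_quotient (R : realType) (w : R) (m b : int) (K j : nat) :
  w ^+ 2 = m%:~R * w + 2 ->
  (forall u v : int, u%:~R * w + v%:~R = 0 -> u = 0 /\ v = 0) ->
  (2 %| b)%Z -> (2 ^+ K %| b ^+ 2 - m * b - 2)%Z -> (j <= K)%N ->
  exists p q r t : int, `|p * t - q * r| = 1 /\
    (w - b%:~R) * (r%:~R * w + t%:~R) = 2 ^+ j * (p%:~R * w + q%:~R).
Proof.
move=> w2 wirr b_even b_root; elim: j => [_|j IHj jK].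
  by exists 1, (- b), 0, 1; split; [rewrite mulr0 subr0|rewrite intrN; ring].
have [p [q [r [t [det e]]]]] := IHj (ltnW jK).
(* Compare the coefficients of [w] and 1 in [e]. *)
have [ep eq] : r * (m - b) + t - 2 ^+ j * p = 0 /\ 2 * r - b * t - 2 ^+ j * q = 0.
  apply: wirr; rewrite !(intrD, intrM, intrN) rmorphXn /=.
  by have := congr1 ( *%R r%:~R) w2; lra.
have [f fE] : exists f : int, b ^+ 2 - m * b - 2 = f * 2 ^+ j.+1.
  by apply/dvdzP; apply: dvdz_trans b_root; rewrite dvdz_exp2l.
have [b' bE] : exists b' : int, b = b' * 2 by apply/dvdzP.
(* Eliminating [t] leaves a multiple of [b^2 - m b - 2], divisible by [2 ^ j.+1], and one of
   [2 ^ j b] with [b] even. *)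
have qE : q = 2 * (- r * f - b' * p).
  apply: (@mulfI _ (2 ^+ j : int)); first by rewrite expf_neq0.
  have -> : 2 ^+ j * q = - r * (b ^+ 2 - m * b - 2) - b * (2 ^+ j * p) by lia.
  by rewrite fE bE exprS; ring.
move: qE; set q' := _ - _ => qE.
(* Coefficients of [(p w + q) (m - w) / 2] and of [(r w + t) (m - w)]. *)
exists (- q'), (q' * m - p), (- t), (t * m - 2 * r); split.
  by apply: etrans det; rewrite qE -normrN; congr `|_|; ring.
have -> : (- t)%:~R * w + (t * m - 2 * r)%:~R =
    (r%:~R * w + t%:~R) * (m%:~R - w).
  by have := congr1 ( *%R r%:~R) w2; rewrite !(intrD, intrM, intrN) /=; lra.
rewrite mulrA e qE exprS !(intrD, intrM, intrN) /=.
rewrite -[2 ^+ j * _ * _]mulrA [2 * 2 ^+ j]mulrC -mulrA; congr (_ * _).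
by have := congr1 ( *%R p%:~R) w2; lra.
Qed.

(** * The number [alpha] and its multiples *)

Theorem theorem6p7 (R : realType) (m K : nat) (m_odd : odd m)
    (m_ge3 : (3 <= m)%N) :
  exists alpha : R, irrational alpha /\
    forall k : nat, (k <= K)%N ->
      limsup_partial_quotient (2 ^+ k * alpha) = (m%:R)%:E.
Proof.
pose N : int := m%:Z ^+ 2 + 8.
pose s : R := Num.sqrt N%:~R.
have s2 : s ^+ 2 = N%:~R by rewrite sqr_sqrtr// ler0z /N; lia.
have NE : N%:~R = m%:R ^+ 2 + 8 :> R by rewrite /N intrD rmorphXn.
have m3 : 3 <= m%:R :> R by rewrite (ler_nat _ 3).
have s0 : 0 < s by rewrite sqrtr_gt0 NE; nra.
have sm : m%:R < s by move: s2; rewrite NE ltNge => s2'; apply/negP => h; nra.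
have sm2 : s < m%:R + 2 by move: s2; rewrite NE ltNge => s2'; apply/negP => h; nra.
(* The only square strictly between [m^2] and [(m + 2)^2] is [(m + 1)^2], and [2 m + 1 = 8] has no
   integer solution. *)
have Nsq (z : int) : z ^+ 2 != N.
  apply/eqP; rewrite /N => h.
  have [m' mE] : exists m' : int, m%:Z = 2 * m' + 1.
    by exists (m./2%:Z); have := odd_double_half m; rewrite m_odd; lia.
  have : (`|z| = m%:Z + 1) by nia.
  by move=> h2; have : `|z| ^+ 2 = (m%:Z + 1) ^+ 2 by [rewrite h2];
    rewrite -normrX; lia.
pose w : R := form_root s (1, m%:Z, 2).
have wE : w = (m%:R + s) / 2 by rewrite /w /form_root mulr1.
have w2 : w ^+ 2 = m%:~R * w + 2.
  by rewrite wE; move: s2; rewrite NE -[m%:~R]/(m%:R); lra.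
have wred : reduced N s (1, m%:Z, 2).
  by split => //=; rewrite ?/N ?mulr1 -?[m%:~R]/(m%:R)//; lra.
have wirr (u v : int) : u%:~R * w + v%:~R = 0 -> u = 0 /\ v = 0.
  move=> h; have [u0|u0] := eqVneq u 0.
    by split=> //; move: h; rewrite u0 mul0r add0r => /eqP; rewrite intr_eq0 => /eqP.
  have sE : u%:~R * s = (- (2 * v + u * m))%:~R :> R.
    by move: h; rewrite wE !(intrD, intrM, intrN) -[m%:~R]/(m%:R) /=; lra.
  have : ((2 * v + u * m) ^+ 2)%:~R = (u ^+ 2 * N)%:~R :> R.
    by rewrite intrM -s2 !rmorphXn /= -exprMn sE intrN sqrrN.
  move=> /eqP; rewrite eqr_int => /eqP e.
  have /dvdzP[z zE] : (u %| 2 * v + u * m)%Z.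
    by rewrite -(@dvdz_pexp2r _ _ 2)// e dvdz_mulr.
  move: e; rewrite zE exprMn mulrC => /mulfI h2.
  by have := Nsq z; rewrite h2 ?eqxx// expf_neq0.
have wle n : partial_quotient w n <= m%:Z.
  rewrite /partial_quotient (complete_quotient_form_root s2 Nsq)//.
  have := reduced_iter s2 Nsq n wred; case: (iter _ _ _) => [[A B] C] rf.
  have [B0 Bs sB] := reduced_lt s2 rf; case: rf => e A0 C0 _ _.
  (* As [A, C >= 1], [B^2 <= m^2 + 4 < (m + 1)^2]; with [s < m + 2] the root stays below [m + 1]. *)
  have Bm : B <= m%:Z by rewrite /N in e; nia.
  have Bm' : B%:~R <= m%:R :> R by rewrite -[m%:R]/(m%:Z%:~R) ler_int.
  have A1 : 1 <= A%:~R :> R by rewrite (ler_int R 1).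
  rewrite -ltzD1 floor_lt_int /form_root ltr_pdivrMr; last by lra.
  by rewrite intrD -[m%:~R]/(m%:R); nra.
have wfl : Num.floor w = m%:Z.
  apply: floor_def; rewrite intrD wE -[m%:~R]/(m%:R); apply/andP; split; lra.
have wrec k : exists2 n, (k <= n)%N & partial_quotient w n = m%:Z.
  have [n kn e] := partial_quotient_recurrent s2 Nsq k wred.
  by exists n; rewrite // e.
have [|b b_even b_root] := @even_root_mod_pow2 m%:Z K; first by lia.
exists ((w - b%:~R) / 2 ^+ K); split.
  move=> [x _ xE]; pose d := denq x; have d0 : d != 0 := denq_neq0 x.
  (* A rational value would yield an integer relation between [w] and 1 with coefficient [d] at
     [w]. *)
  have [] // : (d = 0 /\ - d * b - 2 ^+ K * numq x = 0); last by move/eqP: d0.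
  apply: wirr; rewrite !(intrD, intrM, intrN, rmorphXn) /=.
  have dx : d%:~R * ratr x = (numq x)%:~R :> R.
    rewrite /ratr mulrCA mulfV ?mulr1// intr_eq0 //.
  have wx : w = 2 ^+ K * ratr x + b%:~R by rewrite xE mulrC divfK ?subrK// expf_neq0.
  by rewrite wx -dx; ring.
move=> k kK; apply: same_tail_limsup wle wrec; apply: same_tail_sym.
(* The exponent is [K - k] because [2 ^ k] cancels part of the denominator [2 ^ K]. *)
have [p [q [r [t [det e]]]]] :=
  unimodular_pow2_quotient w2 wirr b_even b_root (leq_subr k K).
apply: (same_tail_moebius (a := p) (b := q) (c := r) (d := t)) => //.
have -> : 2 ^+ k * ((w - b%:~R) / 2 ^+ K) = (w - b%:~R) / 2 ^+ (K - k).
  have {1}-> : K = (k + (K - k))%N by rewrite subnKC.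
  by rewrite exprD; field; rewrite !expf_neq0.
by rewrite mulrAC e mulrC mulKf// expf_neq0.
Qed.
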